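(* Let $\mathcal{H}$ be a Hilbert space, let $\mathcal{K},\mathcal{E}$ be Krein spaces, and let $T\in\mathcal{L}(\mathcal{H},\mathcal{K})$ and $V\in\mathcal{L}(\mathcal{H},\mathcal{E})$ be closed range operators. Let $\rho\in\mathbb{R}$, $\rho\neq0$, and consider the operator $L\in\mathcal{L}(\mathcal{H},\mathcal{K}\times\mathcal{E})$, $Lx=(Tx,Vx)$, where $\mathcal{K}\times\mathcal{E}$ is endowed with the indefinite inner product $[\cdot,\cdot]_\rho$. Then: i) $R(L)$ is closed if and only if $N(T)+N(V)$ is a closed subspace; ii) $R(L)$ is nondegenerate if and only if $N(L^\#L)=N(T)\cap N(V)$; iii) $R(L)$ is pseudo-regular if and only if $N(T)+N(V)$ and $R(L^\#L)$ are closed subspaces.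
   Context: $(\mathcal{H},\langle\cdot,\cdot\rangle)$ is a complex separable Hilbert space; $(\mathcal{K},[\cdot,\cdot]_{\mathcal{K}})$ and $(\mathcal{E},[\cdot,\cdot]_{\mathcal{E}})$ are Krein spaces with their usual Hilbert space topologies; $\mathcal{L}(\cdot,\cdot)$ denotes bounded linear operators. $R(\cdot)$ and $N(\cdot)$ denote range and nullspace. For $\rho\neq0$, $\mathcal{K}\times\mathcal{E}$ is a Krein space with $$[(y,z),(y',z')]_\rho=[y,y']_{\mathcal{K}}+\rho\,[z,z']_{\mathcal{E}}.$$ The adjoints are defined by $[Tx,y]_{\mathcal{K}}=\langle x,T^\#y\rangle$, $[Vx,z]_{\mathcal{E}}=\langle x,V^\#z\rangle$, $[Lx,(y,z)]_\rho=\langle x,L^\#(y,z)\rangle$; hence $L^\#(y,z)=T^\#y+\rho V^\#z$ and $L^\#L=T^\#T+\rho V^\#V$. For a subspace $\mathcal{M}$ of a Krein space $(\mathcal{F},[\cdot,\cdot])$, $\mathcal{M}^{[\perp]}=\{x\in\mathcal{F}:[x,m]=0\ \forall m\in\mathcal{M}\}$; $\mathcal{M}$ is nondegenerate if $\mathcal{M}\cap\mathcal{M}^{[\perp]}=\{0\}$, and pseudo-regular if $\mathcal{M}+\mathcal{M}^{[\perp]}$ is a closed subspace of $\mathcal{F}$.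
   Formalization: In iii), ''R(L) is pseudo-regular'' is taken to mean that R(L) itself is closed and R(L)+R(L)^[⊥] is closed; with only the latter, iii) fails when R(L) is neutral and N(T)+N(V) is not closed. *)

(* Defs.v *)
From HB Require Import structures.
From mathcomp Require Import all_boot all_order all_algebra complex.
From mathcomp Require Import all_classical all_reals all_analysis.

Set Implicit Arguments.
Unset Strict Implicit.
Unset Printing Implicit Defensive.

Import Order.TTheory GRing.Theory Num.Theory.
Import numFieldNormedType.Exports.

Local Open Scope classical_set_scope.
Local Open Scope ring_scope.
Local Open Scope complex_scope.

(* Scalars are R[i] with R : realType.  Its order is partial: [0 < e] forces e
   to be real.  Inner products are linear in the first argument and
   conjugate-linear in the second one. *)

Definition subspace (R : realType) (V : lmodType R[i]) (M : set V) : Prop :=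
  M 0 /\ forall (a : R[i]) x y, M x -> M y -> M (a *: x + y).

Definition sumset (R : realType) (V : lmodType R[i]) (M N : set V) : set V :=
  [set x + y | x in M & y in N].

Definition nullspace (R : realType) (U V : lmodType R[i]) (f : U -> V) :
  set U := f @^-1` [set 0].

Definition separable (T : topologicalType) : Prop :=
  exists2 D : set T, countable D & dense D.

(* The norm of the Banach space H is the one induced by the inner product. *)
Definition hilbert_norm (R : realType) (H : normedModType R[i])
  (dot : {dot H for Num.conj}) : Prop := forall x, `|x| ^+ 2 = dot x x.

(* Cauchy and convergent sequences are those of the norm sqrt (f x x). *)
Definition form_complete (R : realType) (V : lmodType R[i])
  (f : V -> V -> R[i]) (M : set V) : Prop :=
  forall u : nat -> V, (forall n, M (u n)) ->
    (forall e : R[i], 0 < e ->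
       \forall m & n \near \oo, f (u m - u n) (u m - u n) < e) ->
    exists2 l, M l & forall e : R[i], 0 < e ->
       \forall n \near \oo, f (u n - l) (u n - l) < e.

Definition hilbert_subspace (R : realType) (V : lmodType R[i])
  (f : V -> V -> R[i]) (M : set V) : Prop :=
  [/\ subspace M,
      forall x, M x -> x != 0 -> 0 < f x x &
      form_complete f M].

(* K = Kp [+] Km, where (Kp, f) and (Km, - f) are Hilbert spaces; the sum is
   direct because f is positive on Kp and negative on Km. *)
Definition fundamental_decomposition (R : realType) (K : lmodType R[i])
  (f : K -> K -> R[i]) (Kp Km : set K) : Prop :=
  [/\ hilbert_subspace f Kp,
      hilbert_subspace (fun x y => - f x y) Km,
      forall x y, Kp x -> Km y -> f x y = 0 &
      sumset Kp Km = setT].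

(* A Krein space with its usual topology.  A fundamental decomposition gives
   the Hilbert space inner product [x+, y+] - [x-, y-]; different
   decompositions give equivalent norms, so only equivalence with the norm of K
   is required. *)
Definition krein_space (R : realType) (K : normedModType R[i])
  (f : {hermitian K for false & Num.conj}) : Prop :=
  exists Kp Km : set K, fundamental_decomposition f Kp Km /\
    exists a b : R[i], [/\ 0 < a, 0 < b &
      forall x y, Kp x -> Km y ->
        a * `|x + y| ^+ 2 <= f x x - f y y <= b * `|x + y| ^+ 2].

Definition prod_form (R : realType) (K E : lmodType R[i])
  (fK : K -> K -> R[i]) (fE : E -> E -> R[i]) (rho : R) (p q : K * E) : R[i] :=
  fK p.1 q.1 + rho%:C * fE p.2 q.2.

(* The default value is never used for a bounded A: by the Riesz representation
   theorem the vector z exists, and it is unique. *)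
Definition adjoint (R : realType) (H F : lmodType R[i])
  (dot : H -> H -> R[i]) (f : F -> F -> R[i]) (A : H -> F) (w : F) : H :=
  xget 0 [set z | forall x, f (A x) w = dot x z].

Definition orthogonal_companion (R : realType) (F : lmodType R[i])
  (f : F -> F -> R[i]) (M : set F) : set F :=
  [set x | forall m, M m -> f x m = 0].

Definition nondegenerate_subspace (R : realType) (F : lmodType R[i])
  (f : F -> F -> R[i]) (M : set F) : Prop :=
  M `&` orthogonal_companion f M = [set 0].

(* Pseudo-regularity is a property of closed subspaces.  The second condition
   alone does not imply the first: a neutral M is contained in its companion,
   so that the sum is the companion, which is always closed. *)
Definition pseudo_regular (R : realType) (F : normedModType R[i])
  (f : F -> F -> R[i]) (M : set F) : Prop :=
  closed M /\ closed (sumset M (orthogonal_companion f M)).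

(* Main.v *)
Require Import Defs.
From HB Require Import structures.
From mathcomp Require Import all_boot all_order all_algebra complex.
From mathcomp Require Import all_classical all_reals all_analysis.
From mathcomp Require Import ring lra.

Set Implicit Arguments.
Unset Strict Implicit.
Unset Printing Implicit Defensive.

Import Order.TTheory GRing.Theory Num.Theory.
Import numFieldNormedType.Exports.

Local Open Scope classical_set_scope.
Local Open Scope ring_scope.
Local Open Scope complex_scope.


(** A fundamental decomposition makes a Krein space a Hilbert space: if J is
    the identity on the positive part and minus the identity on the negative
    part, then g x y = [x, J y] is an inner product whose norm is equivalent
    to the given one, and [x, y] = g x (J y) ([krein_inner_product]).  On
    K * E the form [., .]_rho is likewise g p (J q) for the product inner
    product and an invertible bounded J, where the factor rho has been moved
    into J.  The statement thus becomes one about bounded operators between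
    Hilbert spaces and the Gram operator J of a form.

    The analytic input is that a bounded T with closed range M has an adjoint
    T* which is bounded below on M ([adjoint_bounded_below]): the vectors w of
    M with |T* w| <= 1 form a weakly bounded set, since g (T x) w is at most
    |x|, so the uniform boundedness principle ([weakly_bounded]) applies.
    Hence a convergent sequence T* w_n with w_n in M forces w_n to converge
    ([adjoint_pair_lim]), and the distance of x to N(T) is at most a constant
    times |T x| ([bounded_inverse]).

    i) If N(T) + N(V) is closed and (T x_n, V x_n) tends to (T a, V b), then
    x_n is close to a modulo N(T) and close to b modulo N(V), so that a - b
    lies in the closure of N(T) + N(V); writing a - b = u + v, the limit is
    L (a - u).  Conversely, if w is a limit of u_n + v_n, then (0, V w) is the
    limit of L u_n, hence equal to some L x, and w = x + (w - x)
    ([range_pair_closed]).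

    ii) The kernel of L# is the companion of R(L), so x is in N(L#L) exactly
    when L x is in the isotropic part of R(L) ([range_nondegenerate]).

    iii) For the same reason R(L) + R(L)^[_|_] is the preimage of R(L#L) under
    the continuous operator L#, which gives one implication
    ([sum_companion_closed]).  For the other one let L#L x_n tend to h.  With
    p_n the orthogonal projection of J L x_n on R(L), L# L x_n = L* p_n, so
    p_n converges to some p with L* p = h; since J^-1 p_n differs from L x_n
    by an element of the companion, J^-1 p lies in R(L) + R(L)^[_|_] when this
    sum is closed, and its component in R(L) is some L x with L#L x = h
    ([range_gram_closed]). *)

(** * Complex scalars *)

Section Scalars.
Variable R : realType.
Implicit Types a z w : R[i].

(** The order of R[i] is partial; all estimates are carried out in R. *)
Definition modulus z : R := complex.Re `|z|.

Lemma modulusE z : `|z| = (modulus z)%:C.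
Proof. by rewrite /modulus normc_def. Qed.

Lemma modulus_ge0 z : 0 <= modulus z.
Proof. by rewrite -ler0c -modulusE normr_ge0. Qed.

Lemma modulus0 : modulus 0 = 0. Proof. by rewrite /modulus normr0. Qed.

Lemma modulus_eq0 z : modulus z = 0 -> z = 0.
Proof. by move=> z0; apply/eqP; rewrite -normr_eq0 modulusE z0. Qed.

Lemma modulusM z w : modulus (z * w) = modulus z * modulus w.
Proof. by rewrite /modulus normrM !modulusE -rmorphM. Qed.

Lemma modulusN z : modulus (- z) = modulus z.
Proof. by rewrite /modulus normrN. Qed.

Lemma modulusD z w : modulus (z + w) <= modulus z + modulus w.
Proof. by rewrite -lecR rmorphD /= -!modulusE ler_normD. Qed.

Lemma modulusR (x : R) : modulus x%:C = `|x|.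
Proof. by rewrite /modulus normc_def /= expr0n addr0 sqrtr_sqr. Qed.

Lemma conjC_conjc z : z^*%R = conjc z. Proof. by []. Qed.

Lemma modulusJ z : modulus (z^*%R) = modulus z.
Proof. by rewrite /modulus norm_conjC. Qed.

Lemma complexReJ z : complex.Re (z^*%R) = complex.Re z.
Proof. by case: z. Qed.

Lemma Re_le_modulus z : `|complex.Re z| <= modulus z.
Proof. by rewrite -lecR -modulusE normc_ge_Re. Qed.

Lemma complexReD z w : complex.Re (z + w) = complex.Re z + complex.Re w.
Proof. by case: z; case: w. Qed.
Lemma complexReN z : complex.Re (- z) = - complex.Re z.
Proof. by case: z. Qed.
Lemma complexReZ (x : R) z : complex.Re (x%:C * z) = x * complex.Re z.
Proof. by case: z => a b; rewrite /= mul0r subr0. Qed.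

Lemma mul_conj z : z * z^*%R = (modulus z ^+ 2)%:C.
Proof. by rewrite -normCK modulusE rmorphXn. Qed.

Lemma modulus_small_eq0 (z : R[i]) :
  (forall e : R, 0 < e -> modulus z <= e) -> z = 0.
Proof.
move=> h; apply/modulus_eq0/eqP; rewrite eq_le modulus_ge0 andbT.
by apply/ler_addgt0Pr => e e0; rewrite add0r h.
Qed.

Lemma invn_small (e : R) : 0 < e ->
  exists N, forall n, (N <= n)%N -> n.+1%:R^-1 < e.
Proof.
move=> e0; exists (Num.truncn e^-1) => n Nn.
rewrite invf_plt ?posrE// (lt_le_trans (truncnS_gt _))// ler_nat.
by rewrite ltnS.
Qed.

End Scalars.

(** * Inner products *)

Definition inner_product (R : realType) (V : lmodType R[i])
  (g : V -> V -> R[i]) : Prop :=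
  [/\ forall a x y z, g (a *: x + y) z = a * g x z + g y z,
      forall x y, g y x = (g x y)^*%R,
      forall x, 0 <= g x x &
      forall x, g x x = 0 -> x = 0].

Definition nrm (R : realType) (V : lmodType R[i])
  (g : V -> V -> R[i]) (x : V) : R := Num.sqrt (complex.Re (g x x)).

Section InnerProduct.
Variables (R : realType) (V : lmodType R[i]) (g : V -> V -> R[i]).
Hypothesis gP : inner_product g.
Implicit Types (a : R[i]) (x y z : V).

Lemma ip_linl a x y z : g (a *: x + y) z = a * g x z + g y z.
Proof. by case: gP => ->. Qed.

Lemma ipC x y : g y x = (g x y)^*%R. Proof. by case: gP => _ ->. Qed.

Lemma ipDl x y z : g (x + y) z = g x z + g y z.
Proof. by rewrite -[x in LHS]scale1r ip_linl mul1r. Qed.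

Lemma ip0l z : g 0 z = 0.
Proof.
have := ip_linl 1 0 0 z.
by rewrite scaler0 addr0 mul1r -{1}[g 0 z]addr0 => /addrI.
Qed.

Lemma ipZl a x z : g (a *: x) z = a * g x z.
Proof. by rewrite -[a *: x]addr0 ip_linl ip0l addr0. Qed.

Lemma ipNl x z : g (- x) z = - g x z.
Proof. by rewrite -scaleN1r ipZl mulN1r. Qed.

Lemma ipBl x y z : g (x - y) z = g x z - g y z.
Proof. by rewrite ipDl ipNl. Qed.

Lemma ip0r z : g z 0 = 0.
Proof. by rewrite ipC ip0l rmorph0. Qed.

Lemma ipDr x y z : g z (x + y) = g z x + g z y.
Proof. by rewrite ipC ipDl rmorphD /= -!ipC. Qed.

Lemma ipZr a x z : g z (a *: x) = a^*%R * g z x.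
Proof. by rewrite ipC ipZl rmorphM /= -!ipC. Qed.

Lemma ipNr x z : g z (- x) = - g z x.
Proof. by rewrite ipC ipNl rmorphN /= -!ipC. Qed.

Lemma ipBr x y z : g z (x - y) = g z x - g z y.
Proof. by rewrite ipDr ipNr. Qed.

Lemma nrm_ge0 x : 0 <= nrm g x. Proof. exact: sqrtr_ge0. Qed.

Lemma ip_self x : g x x = (nrm g x ^+ 2)%:C.
Proof.
have g0 : 0 <= g x x by case: gP.
have gr : (complex.Re (g x x))%:C = g x x by rewrite RRe_real// ger0_real.
by rewrite sqr_sqrtr // -ler0c gr.
Qed.

Lemma sqr_nrm x : nrm g x ^+ 2 = complex.Re (g x x).
Proof. by rewrite ip_self. Qed.

Lemma nrm_eq0 x : nrm g x = 0 -> x = 0.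
Proof. by move=> x0; case: gP => _ _ _; apply; rewrite ip_self x0 expr0n. Qed.

Lemma nrm0 : nrm g 0 = 0. Proof. by rewrite /nrm ip0l sqrtr0. Qed.

Lemma nrmZ a x : nrm g (a *: x) = modulus a * nrm g x.
Proof.
rewrite /nrm ipZl ipZr mulrA mul_conj complexReZ sqrtrM ?sqr_ge0//.
by rewrite sqrtr_sqr ger0_norm ?modulus_ge0.
Qed.

Lemma nrmN x : nrm g (- x) = nrm g x.
Proof. by rewrite /nrm ipNl ipNr opprK. Qed.

Lemma nrmB x y : nrm g (x - y) = nrm g (y - x).
Proof. by rewrite -nrmN opprB. Qed.

Lemma sqr_nrmD x y :
  nrm g (x + y) ^+ 2 = nrm g x ^+ 2 + 2 * complex.Re (g x y) + nrm g y ^+ 2.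
Proof.
by rewrite !sqr_nrm ipDl !ipDr [g y x]ipC !complexReD complexReJ; ring.
Qed.

Lemma sqr_nrmB x y :
  nrm g (x - y) ^+ 2 = nrm g x ^+ 2 - 2 * complex.Re (g x y) + nrm g y ^+ 2.
Proof. by rewrite sqr_nrmD ipNr nrmN complexReN; ring. Qed.

Lemma cauchy_schwarz x y : modulus (g x y) <= nrm g x * nrm g y.
Proof.
have [y0|ny] := eqVneq (nrm g y) 0.
  by rewrite (nrm_eq0 y0) ip0r nrm0 modulus0 mulr0.
have yp : 0 < nrm g y by rewrite lt_def ny nrm_ge0.
rewrite -(@ler_pXn2r _ 2) ?nnegrE ?modulus_ge0 ?mulr_ge0 ?nrm_ge0//.
(* x - t (x, y) y is the component of x orthogonal to y. *)
set t := (nrm g y ^+ 2)^-1.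
have := sqr_ge0 (nrm g (x - (t%:C * g x y) *: y)).
rewrite sqr_nrmB nrmZ modulusM modulusR ipZr rmorphM/= -mulrA.
have -> : ((t%:C)^*%R : R[i]) = t%:C by rewrite conjC_conjc conjc_real.
rewrite complexReZ [_^* * _]mulrC mul_conj /=.
set A := modulus _; set B := nrm g x; rewrite [`|t|]ger0_norm; last first.
  by rewrite invr_ge0 sqr_ge0.
rewrite !exprMn /t.
set D := nrm g y ^+ 2 => h.
have Dp : 0 < D by rewrite exprn_gt0.
have e : B ^+ 2 - 2 * (D^-1 * A ^+ 2) + D^-1 ^+ 2 * A ^+ 2 * D =
    B ^+ 2 - A ^+ 2 / D.
  by field; rewrite gt_eqF.
by move: h; rewrite e subr_ge0 ler_pdivrMr.
Qed.

Lemma nrmD x y : nrm g (x + y) <= nrm g x + nrm g y.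
Proof.
rewrite -(@ler_pXn2r _ 2) ?nnegrE ?addr_ge0 ?nrm_ge0//.
rewrite sqr_nrmD sqrrD lerD2r lerD2l -[leRHS]mulr_natl ler_pM2l//.
exact: le_trans (ler_norm _) (le_trans (Re_le_modulus _) (cauchy_schwarz _ _)).
Qed.

Lemma nrm_triangle z x y : nrm g (x - y) <= nrm g (x - z) + nrm g (z - y).
Proof. by rewrite -[x - y](subrKA z) nrmD. Qed.

End InnerProduct.

(** * Hilbert spaces: Riesz representation and uniform boundedness *)

Section Hilbert.
Variables (R : realType) (V : lmodType R[i]) (g : V -> V -> R[i]).

Definition nlim (u : nat -> V) (l : V) : Prop :=
  forall e : R, 0 < e -> exists N, forall n, (N <= n)%N -> nrm g (u n - l) < e.

Definition ncauchy (u : nat -> V) : Prop :=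
  forall e : R, 0 < e -> exists N, forall m n, (N <= m)%N -> (N <= n)%N ->
    nrm g (u m - u n) < e.

Definition hilbert : Prop :=
  inner_product g /\ forall u, ncauchy u -> exists l, nlim u l.

Definition nclosed (A : set V) : Prop :=
  forall x, (forall e : R, 0 < e -> exists2 a, A a & nrm g (x - a) < e) -> A x.

Hypothesis gH : hilbert.
Let gP : inner_product g := proj1 gH.

Lemma nclosed_lim (A : set V) u l : nclosed A -> (forall n, A (u n)) ->
  nlim u l -> A l.
Proof.
move=> clA Au ul; apply: clA => e /ul[N /(_ N (leqnn N))].
by exists (u N) => //; rewrite (nrmB gP).
Qed.

Lemma nlim_le u l z (c : R) N : nlim u l ->
  (forall n, (N <= n)%N -> nrm g (u n - z) <= c) -> nrm g (l - z) <= c.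
Proof.
move=> ul uz; apply/ler_addgt0Pr => e /ul[N' h].
have n1 := leq_maxl N N'; have n2 := leq_maxr N N'.
have := nrm_triangle gP (u (maxn N N')) l z.
by have := h _ n2; have := uz _ n1; rewrite (nrmB gP l (u _)); lra.
Qed.

(** The representing vector is the minimiser p on M of
    Phi x = |x|^2 - 2 Re (phi x), whose stationarity condition is
    phi = g _ p.  The parallelogram law makes every minimising sequence
    Cauchy. *)
Lemma riesz (M : set V) (phi : V -> R[i]) (B : R) :
  Defs.subspace M -> nclosed M ->
  (forall a x y, phi (a *: x + y) = a * phi x + phi y) ->
  (forall x, M x -> modulus (phi x) <= B * nrm g x) ->
  exists2 p, M p & forall m, M m -> phi m = g m p.
Proof.
move=> [M0 Mlin] clM philin phiB.
have MD x y : M x -> M y -> M (x + y).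
  by move=> Mx My; rewrite -[x]scale1r; apply: Mlin.
have MZ a x : M x -> M (a *: x).
  by move=> Mx; rewrite -[a *: x]addr0; apply: Mlin.
have phi0 : phi 0 = 0.
  have := philin 1 0 0.
  by rewrite scaler0 addr0 mul1r -{1}[phi 0]addr0 => /addrI.
have phiD x y : phi (x + y) = phi x + phi y.
  by rewrite -[x in LHS]scale1r philin mul1r.
have phiZ a x : phi (a *: x) = a * phi x.
  by rewrite -[a *: x]addr0 philin phi0 addr0.
pose Phi x : R := nrm g x ^+ 2 - 2 * complex.Re (phi x).
pose S := [set Phi x | x in M].
have hS : has_inf S.
  split; first by exists (Phi 0), 0.
  exists (- (B ^+ 2)) => _ [x Mx <-].
  have := le_trans (ler_norm _) (le_trans (Re_le_modulus (phi x)) (phiB x Mx)).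
  by rewrite /Phi; have := sqr_ge0 (nrm g x - B); nra.
pose d := inf S.
have dle x : M x -> d <= Phi x.
  by move=> Mx; apply: ge_inf; [case: hS | exists x].
have /choice[u uP] n : exists x, M x /\ Phi x < d + n.+1%:R^-1.
  have n0 : 0 < n.+1%:R^-1 :> R by rewrite invr_gt0 ltr0Sn.
  have [_ [x Mx <-] h] := inf_adherent n0 hS.
  by exists x.
have uu m n : nrm g (u m - u n) ^+ 2 <= 2 * (m.+1%:R^-1 + n.+1%:R^-1).
  have [Mm Pm] := uP m; have [Mn Pn] := uP n.
  (* The midpoint of u m and u n lies in M, so Phi is at least d there. *)
  have := dle _ (MZ (2^-1)%:C _ (MD _ _ Mm Mn)).
  rewrite /Phi (nrmZ gP) modulusR ger0_norm ?invr_ge0//.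
  rewrite phiZ phiD complexReZ complexReD.
  move: Pm Pn; rewrite /Phi exprMn (sqr_nrmB gP) (sqr_nrmD gP).
  set a := m.+1%:R^-1 => Pm; set b := n.+1%:R^-1 => Pn.
  have -> : (2^-1 : R) ^+ 2 = 4^-1 by field.
  by lra.
have uC : ncauchy u.
  move=> e e0; have [|N hN] := @invn_small R (e ^+ 2 / 4).
    by rewrite divr_gt0 ?exprn_gt0.
  exists N => m n Nm Nn; rewrite -(@ltr_pXn2r _ 2) ?nnegrE ?nrm_ge0 ?ltW//.
  apply: le_lt_trans (uu m n) _.
  have := hN m Nm; have := hN n Nn.
  by move: m.+1%:R^-1 n.+1%:R^-1 (e ^+ 2) => a b c; lra.
have [p up] := gH.2 _ uC.
exists p; first by apply: nclosed_lim clM _ up => n; case: (uP n).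
move=> k Mk.
(* Stationarity of Phi holds at u n up to an error that tends to 0. *)
have step n :
    modulus (g k (u n) - phi k) ^+ 2 <= (nrm g k ^+ 2 + 1) * n.+1%:R^-1.
  have [Mn Pn] := uP n.
  set s := nrm g k ^+ 2; set D := g k (u n) - phi k.
  have s0 : 0 <= s by exact: sqr_ge0.
  (* The step a nearly minimises Phi (u n + a k); s + 1 replaces
     s = |k|^2 to avoid dividing by 0. *)
  pose t : R := (s + 1)^-1.
  have t0 : 0 < t by rewrite invr_gt0; lra.
  pose a : R[i] := - (t%:C * D^*%R).
  have := dle _ (MD _ _ (MZ a k Mk) Mn).
  move: Pn; rewrite /Phi (sqr_nrmD gP) phiD phiZ (nrmZ gP) (ipZl gP) complexReD.
  rewrite modulusN modulusM modulusR modulusJ [`|t|]ger0_norm ?(ltW t0)//.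
  have -> : phi k = g k (u n) - D by rewrite /D opprB addrC subrK.
  rewrite [a * (_ - D)]mulrBr complexReD complexReN.
  have -> : complex.Re (a * D) = - (t * modulus D ^+ 2).
    by rewrite /a mulNr complexReN -mulrA complexReZ [_^* * _]mulrC mul_conj.
  rewrite !exprMn -/s; set b := n.+1%:R^-1.
  set X := complex.Re _; set m2 := modulus D ^+ 2.
  move=> h1 h2.
  have m0 : 0 <= m2 by exact: sqr_ge0.
  have ts : t * (s + 1) = 1 by rewrite mulVf// gt_eqF//; lra.
  have h3 : t * m2 <= b.
    have : t ^+ 2 * m2 * s = t * m2 - t * (t * m2).
      by rewrite -[in RHS](mulr1 (t * m2)) -{1}ts; ring.
    have : 0 <= t * (t * m2) by apply: mulr_ge0 (ltW t0) (mulr_ge0 (ltW t0) m0).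
    by lra.
  have : (s + 1) * (t * m2) <= (s + 1) * b by rewrite ler_wpM2l//; lra.
  by rewrite mulrA [(s+1)*t]mulrC ts mul1r.
apply/eqP; rewrite -subr_eq0 -oppr_eq0 opprB; apply/eqP.
apply: modulus_small_eq0 => e e0.
set s := nrm g k.
have s0 : 0 <= s by exact: nrm_ge0.
have [|N1 h1] := @invn_small R ((e / 2) ^+ 2 / (s ^+ 2 + 1)).
  by rewrite divr_gt0 ?exprn_gt0 ?divr_gt0// ltr_wpDl// sqr_ge0.
have [|N2 h2] := up (e / (2 * (s + 1))).
  by rewrite divr_gt0// mulr_gt0// ltr_wpDl.
set n := maxn N1 N2.
have {}h1 : modulus (g k (u n) - phi k) <= e / 2.
  rewrite -(@ler_pXn2r _ 2) ?nnegrE ?modulus_ge0 ?divr_ge0 ?(ltW e0)//.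
  apply: le_trans (step n) _.
  rewrite -/s mulrC -ler_pdivlMr ?ltr_wpDl ?sqr_ge0//.
  by apply/ltW/h1/leq_maxl.
have {}h2 : modulus (g k (p - u n)) <= e / 2.
  apply: le_trans (cauchy_schwarz gP _ _) _; rewrite -/s (nrmB gP).
  have := ltW (h2 n (leq_maxr _ _)).
  rewrite invfM mulrA ler_pdivlMr ?ltr_wpDl// => h.
  by have := nrm_ge0 g (u n - p); nra.
have -> : g k p - phi k = g k (p - u n) + (g k (u n) - phi k).
  by rewrite (ipBr gP) addrA subrK.
by apply: le_trans (modulusD _ _) _; lra.
Qed.

Lemma projection (M : set V) x : Defs.subspace M -> nclosed M ->
  exists2 p, M p & forall m, M m -> g m x = g m p.
Proof.
move=> sM cM; apply: (@riesz M (g^~ x) (nrm g x)) => //.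
  by move=> a y z; rewrite (ip_linl gP).
by move=> m _; rewrite mulrC (cauchy_schwarz gP).
Qed.

(** Uniform boundedness by a gliding hump.  If S were unbounded, choose
    w n in S with norm larger than 2 n 3^n, and points x n, each at distance at
    most 3^-n from the next one, such that |g (x n.+1) (w n)| is at least
    3^-n |w n|: one of x n + xi and x n - xi works as soon as |xi| = 3^-n and
    xi is collinear to w n.  The later moves add up to at most 3^-n / 2, so
    that the limit y of x satisfies |g y (w n)| >= n for all n. *)
Lemma weakly_bounded (S : set V) :
  (forall y, exists B, forall w, S w -> modulus (g y w) <= B) ->
  exists B, forall w, S w -> nrm g w <= B.
Proof.
move=> wb; apply: contrapT => nb.
have /choice[w wP] n : exists w, S w /\ 2 * n%:R * 3 ^+ n < nrm g w.
  apply: contrapT => nw; apply: nb; exists (2 * n%:R * 3 ^+ n) => w Sw.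
  by rewrite leNgt; apply/negP => h; apply: nw; exists w.
have /choice[f fP] (nx : nat * V) : exists x',
    nrm g (x' - nx.2) <= 3 ^- nx.1 /\
    3 ^- nx.1 * nrm g (w nx.1) <= modulus (g x' (w nx.1)).
  case: nx => n x /=; set r : R := 3 ^- n.
  have r0 : 0 < r by rewrite invr_gt0 exprn_gt0.
  have wn0 : 0 < nrm g (w n).
    by have [_] := wP n; apply: le_lt_trans; rewrite !mulr_ge0// exprn_ge0.
  (* g xi (w n) is half the difference of the values at x + xi and
     x - xi, so one of the two has modulus at least |g xi (w n)|. *)
  pose xi := (r / nrm g (w n))%:C *: w n.
  have nxi : nrm g xi = r.
    rewrite /xi (nrmZ gP) modulusR ger0_norm ?divr_ge0 ?ltW// divfK//.
    by rewrite gt_eqF.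
  have gxi : modulus (g xi (w n)) = r * nrm g (w n).
    rewrite /xi (ipZl gP) modulusM (ip_self gP) !modulusR.
    rewrite !ger0_norm ?sqr_ge0 ?divr_ge0 ?ltW//; field.
    by rewrite gt_eqF.
  have [h|h] := lerP (r * nrm g (w n)) (modulus (g (x + xi) (w n))).
    by exists (x + xi); split; rewrite // addrC addKr nxi.
  exists (x - xi); split; first by rewrite addrC addKr (nrmN gP) nxi.
  have e : (2 : R)%:C * g xi (w n) = g (x + xi) (w n) - g (x - xi) (w n).
    by rewrite rmorph_nat (ipBl gP) (ipDl gP); ring.
  have : modulus ((2 : R)%:C * g xi (w n)) = 2 * (r * nrm g (w n)).
    by rewrite modulusM gxi modulusR ger0_norm.
  rewrite e => e2; have := modulusD (g (x + xi) (w n)) (- g (x - xi) (w n)).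
  by rewrite e2 modulusN; lra.
pose fix x n := if n is m.+1 then f (m, x m) else 0.
have xS n k : nrm g (x (n + k)%N - x n) <= 3 / 2 * (3 ^- n - 3 ^- (n + k)).
  elim: k => [|k IH]; first by rewrite addn0 !subrr (nrm0 gP) mulr0.
  rewrite addnS.
  apply: le_trans (nrm_triangle gP (x (n + k)%N) _ _) _.
  have [/= h _] := fP ((n + k)%N, x (n + k)%N).
  have -> : (3 : R) ^- (n + k).+1 = 3 ^- (n + k) / 3.
    by rewrite exprS invfM mulrC.
  by move: IH h => /=; lra.
have xS' n m : (n <= m)%N -> nrm g (x m - x n) <= 3 / 2 * 3 ^- n.
  move=> nm; rewrite -(subnKC nm); apply: le_trans (xS _ _) _.
  have : 0 <= (3 : R) ^- (n + (m - n)) by rewrite invr_ge0 exprn_ge0.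
  by lra.
have p3 n : n.+1%:R <= (3 : R) ^+ n.
  elim: n => [|n IH]; first by rewrite expr0.
  by rewrite exprS -natr1; have : 1 <= n.+1%:R :> R := ler1n _ _; lra.
have xC : ncauchy x.
  move=> e e0; have [|N hN] := @invn_small R (e / 3); first by rewrite divr_gt0.
  exists N => m n Nm Nn; apply: le_lt_trans (nrm_triangle gP (x N) _ _) _.
  have := xS' _ _ Nm; have := xS' _ _ Nn; rewrite (nrmB gP (x N)).
  have : (3 : R) ^- N <= N.+1%:R^-1 by rewrite lef_pV2 ?posrE ?exprn_gt0.
  by have := hN N (leqnn N); move: N.+1%:R^-1 => a; lra.
have [y xy] := gH.2 _ xC.
have [B hB] := wb y.
have nB n : n%:R <= B.
  have [Sw hw] := wP n; apply: le_trans _ (hB _ Sw).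
  have [_ /= h] := fP (n, x n).
  have d : nrm g (y - x n.+1) <= 2^-1 * 3 ^- n.
    apply: (nlim_le xy (N := n.+1)) => m nm; apply: le_trans (xS' _ _ nm) _.
    by rewrite exprS invfM; lra.
  have := modulusD (g y (w n)) (g (x n.+1 - y) (w n)).
  rewrite (ipBl gP) addrC subrK.
  have := cauchy_schwarz gP (x n.+1 - y) (w n).
  rewrite (ipBl gP) (nrmB gP (x n.+1)) => h2 h3.
  have i3 : 0 < (3 : R) ^- n by rewrite invr_gt0 exprn_gt0.
  have : 3 ^- n * (2 * n%:R * 3 ^+ n) <= 3 ^- n * nrm g (w n).
    by rewrite ler_pM2l// ltW.
  rewrite mulrCA mulVf ?gt_eqF ?exprn_gt0// mulr1 => h4.
  have : nrm g (y - x n.+1) * nrm g (w n) <= 2^-1 * 3 ^- n * nrm g (w n).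
    by rewrite ler_wpM2r ?nrm_ge0.
  by lra.
have := nB (Num.truncn B).+1; rewrite leNgt truncnS_gt //.
Qed.

End Hilbert.

(** * Operators with closed range *)

Section ClosedSets.
Variables (R : realType) (V : lmodType R[i]) (g : V -> V -> R[i]).
Hypothesis gP : inner_product g.

Lemma nclosed_seq (A : set V) :
  (forall u l, (forall n, A (u n)) -> nlim g u l -> A l) -> nclosed g A.
Proof.
move=> seqA x xA.
have /choice[u uP] (n : nat) : exists a, A a /\ nrm g (x - a) < n.+1%:R^-1.
  by have [|a Aa xa] := xA n.+1%:R^-1; [rewrite invr_gt0 ltr0Sn | exists a].
apply: (seqA u) => [n|e e0]; first by case: (uP n).
have [N hN] := invn_small e0; exists N => n Nn.
by rewrite (nrmB gP); apply: lt_trans (hN n Nn); case: (uP n).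
Qed.

Lemma nlim_ip u l k (e : R) : nlim g u l -> 0 < e ->
  exists N, forall n, (N <= n)%N -> modulus (g k (u n - l)) < e.
Proof.
move=> ul e0; have k0 : 0 < nrm g k + 1 by rewrite ltr_wpDl ?nrm_ge0.
have [|N hN] := ul (e / (nrm g k + 1)); first by rewrite divr_gt0.
exists N => n Nn; apply: le_lt_trans (cauchy_schwarz gP _ _) _.
have := hN n Nn; rewrite ltr_pdivlMr// => h.
have := nrm_ge0 g (u n - l); have := nrm_ge0 g k.
by nra.
Qed.

End ClosedSets.

Section ClosedRange.
Variables (R : realType) (H F : lmodType R[i]).
Variables (dot : H -> H -> R[i]) (g : F -> F -> R[i]) (T : H -> F) (b : R).
Hypothesis dotH : hilbert dot.
Hypothesis gH : hilbert g.
Hypothesis Tlin : linear T.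
Hypothesis Tb : forall x, nrm g (T x) <= b * nrm dot x.
Let dotP : inner_product dot := proj1 dotH.
Let gP : inner_product g := proj1 gH.

Lemma lin0 : T 0 = 0.
Proof.
by have := Tlin 1 0 0; rewrite scaler0 addr0 scale1r -{1}[T 0]addr0 => /addrI.
Qed.
Lemma linD x y : T (x + y) = T x + T y.
Proof. by rewrite -[x in LHS]scale1r Tlin scale1r. Qed.
Lemma linZ a x : T (a *: x) = a *: T x.
Proof. by rewrite -[a *: x]addr0 Tlin lin0 addr0. Qed.
Lemma linB x y : T (x - y) = T x - T y.
Proof. by rewrite linD -[- y]scaleN1r linZ scaleN1r. Qed.

Lemma subspace_range : Defs.subspace (range T).
Proof.
split; first by exists 0; rewrite // lin0.
by move=> a _ _ [x _ <-] [y _ <-]; exists (a *: x + y); rewrite // Tlin.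
Qed.

(** The relation h = T* w.  Its defining identity is
    used directly, as it passes to limits in w and h. *)
Definition adjoint_pair w h := forall y, g (T y) w = dot y h.

Lemma adjoint_pair_exists w : exists h, adjoint_pair w h.
Proof.
have [||||h _ hP] :=
  @riesz _ _ dot dotH setT (fun y => g (T y) w) (b * nrm g w).
- by split.
- by move=> x _.
- by move=> a x y; rewrite Tlin (ip_linl gP).
- move=> x _; apply: le_trans (cauchy_schwarz gP _ _) _.
  by rewrite mulrAC ler_wpM2r ?nrm_ge0.
by exists h => y; apply: hP.
Qed.

Lemma adjoint_pair_lin a w w' h h' : adjoint_pair w h -> adjoint_pair w' h' ->
  adjoint_pair (a *: w + w') (a *: h + h').
Proof.
move=> wh wh' y; rewrite (ipDr gP) (ipZr gP) wh wh'.
by rewrite (ipDr dotP) (ipZr dotP).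
Qed.

Lemma adjoint_pairB w w' h h' : adjoint_pair w h -> adjoint_pair w' h' ->
  adjoint_pair (w - w') (h - h').
Proof.
by move=> wh wh' y; rewrite (ipBr gP) (ipBr dotP) wh wh'.
Qed.

(** The set of w in R(T) with |T* w| <= 1 is weakly bounded: to test it
    against y one may replace y by its projection T x on R(T), and
    |g (T x) w| <= |x|.  The bound is then extended by homogeneity. *)
Lemma adjoint_bounded_below : nclosed g (range T) ->
  exists2 C : R, 0 < C &
    forall w h, range T w -> adjoint_pair w h -> nrm g w <= C * nrm dot h.
Proof.
move=> clT; have sT := subspace_range.
pose S := [set w | range T w /\ forall x, modulus (g (T x) w) <= nrm dot x].
have [|B hB] := @weakly_bounded _ _ _ gH S.
  move=> y; have [p [x _ <-] hp] := projection gH y sT clT.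
  exists (nrm dot x) => w [Tw /(_ x)].
  by rewrite [g y w](ipC gP) modulusJ (hp w Tw) [g (T x) w](ipC gP) modulusJ.
exists (`|B| + 1) => [|w h Tw wh]; first by rewrite ltr_wpDl.
(* If T* w = 0 then w is orthogonal to R(T), which contains w. *)
have [h0|h0] := eqVneq (nrm dot h) 0.
  case: Tw wh => x _ <- /(_ x); rewrite (nrm_eq0 dotP h0) (ip0r dotP).
  rewrite (ip_self gP) (nrm0 dotP) mulr0 => /complexI/eqP.
  by rewrite sqrf_eq0 => /eqP->.
have hp : 0 < nrm dot h by rewrite lt_def h0 nrm_ge0.
pose c : R := (nrm dot h)^-1.
have cp : 0 < c by rewrite invr_gt0.
have mc : modulus c%:C = c by rewrite modulusR gtr0_norm.
have /hB : S (c%:C *: w).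
  split; first by case: sT => s0 /(_ c%:C w 0 Tw s0); rewrite addr0.
  move=> x; rewrite (ipZr gP) modulusM modulusJ mc wh mulrC ler_pdivrMr//.
  exact: cauchy_schwarz.
rewrite (nrmZ gP) mc mulrC ler_pdivrMr// => /le_trans; apply.
by rewrite ler_pM2r// (le_trans (ler_norm _))// lerDl.
Qed.

(** T* is bounded below on R(T), so convergence of T* (w n) makes w n a
    Cauchy sequence. *)
Lemma adjoint_pair_lim w h hl : nclosed g (range T) ->
  (forall n, range T (w n)) -> (forall n, adjoint_pair (w n) (h n)) ->
  nlim dot h hl ->
  exists wl, [/\ range T wl, nlim g w wl & adjoint_pair wl hl].
Proof.
move=> clT Tw wh hhl; have [C C0 hC] := adjoint_bounded_below clT.
have wC : ncauchy g w.
  move=> e e0; have [|N hN] := hhl (e / (2 * C)).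
    by rewrite divr_gt0// mulr_gt0.
  exists N => m n Nm Nn.
  have Twmn : range T (w m - w n).
    have [_ /(_ (-1) (w n) (w m) (Tw n) (Tw m))] := subspace_range.
    by rewrite scaleN1r addrC.
  apply: le_lt_trans (hC _ _ Twmn (adjoint_pairB (wh m) (wh n))) _.
  rewrite mulrC -ltr_pdivlMr//.
  apply: le_lt_trans (nrm_triangle dotP hl _ _) _.
  have := hN m Nm; have := hN n Nn; rewrite (nrmB dotP hl).
  have -> : e / (2 * C) = e / C / 2 by field; rewrite gt_eqF.
  by move: (e / C) => z; lra.
have [wl wwl] := gH.2 _ wC; exists wl; split=> //.
  exact: nclosed_lim clT Tw wwl.
move=> y; apply/eqP; rewrite -subr_eq0; apply/eqP/modulus_small_eq0 => e e0.
have e2 : 0 < e / 2 by rewrite divr_gt0.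
have [N1 h1] := nlim_ip gP (T y) wwl e2.
have [N2 h2] := nlim_ip dotP y hhl e2.
have := h1 _ (leq_maxl N1 N2); have := h2 _ (leq_maxr N1 N2).
rewrite (ipBr gP) (ipBr dotP) wh; move: (dot y (h _)) => z a2 a1.
have -> : g (T y) wl - dot y hl = - (z - g (T y) wl) + (z - dot y hl) by ring.
by apply: le_trans (modulusD _ _) _; rewrite modulusN; lra.
Qed.

Lemma kernel_nclosed : nclosed dot (nullspace T).
Proof.
move=> x hx; apply: (nrm_eq0 gP); apply/eqP; rewrite eq_le nrm_ge0 andbT.
apply/ler_addgt0Pr => e e0; rewrite add0r.
have b0 : 0 < `|b| + 1 by rewrite ltr_wpDl.
have [|a Ta xa] := hx (e / (`|b| + 1)); first by rewrite divr_gt0.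
have -> : T x = T (x - a) by rewrite linB Ta subr0.
apply: le_trans (Tb _) _; move: xa; rewrite ltr_pdivlMr//.
have := nrm_ge0 dot (x - a); have := ler_norm b.
by nra.
Qed.

Lemma subspace_kernel : Defs.subspace (nullspace T).
Proof.
split; first exact: lin0.
by move=> a x y Tx Ty; rewrite /nullspace /= Tlin Tx Ty scaler0 addr0.
Qed.

(** The same argument for T in place of T*: the range N' of T* restricted
    to R(T) is closed and its orthogonal is N(T), so a vector x of N(T)^_|_ is
    tested against y only through the projection T* w of y on N', where
    |dot x (T* w)| <= |T x| |w|.  Hence the x in N(T)^_|_ with |T x| <= 1 form
    a weakly bounded set. *)
Lemma bounded_inverse : nclosed g (range T) ->
  exists2 C : R, 0 < C &
    forall x, exists2 u, T u = 0 & nrm dot (x - u) <= C * nrm g (T x).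
Proof.
move=> clT; have [sT0 sT] := subspace_range.
pose N' := [set h | exists2 w, range T w & adjoint_pair w h].
have sN' : Defs.subspace N'.
  split; first by exists 0 => // y; rewrite (ip0r gP) (ip0r dotP).
  move=> a h h' [w Tw wh] [w' Tw' wh']; exists (a *: w + w'); first exact: sT.
  exact: adjoint_pair_lin.
have clN' : nclosed dot N'.
  apply: (nclosed_seq dotP) => h hl hN' hhl.
  have /choice[w wP] n : exists w, range T w /\ adjoint_pair w (h n).
    by have [w] := hN' n; exists w.
  have [wl [Twl _ wlhl]] :=
    adjoint_pair_lim clT (fun n => (wP n).1) (fun n => (wP n).2) hhl.
  by exists wl.
pose S := [set x | (forall m, T m = 0 -> dot m x = 0) /\ nrm g (T x) <= 1].
have [|B hB] := @weakly_bounded _ _ _ dotH S.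
  move=> y; have [p [w Tw wp] hp] := projection dotH y sN' clN'.
  have Tz0 : T (y - p) = 0.
    apply: (nrm_eq0 gP); have [h hP] := adjoint_pair_exists (T (y - p)).
    have : g (T (y - p)) (T (y - p)) = 0.
      rewrite hP (ipC dotP) (ipBr dotP) hp ?subrr ?rmorph0//.
      by exists (T (y - p)) => //; exists (y - p).
    by rewrite (ip_self gP) => /complexI/eqP; rewrite sqrf_eq0 => /eqP.
  exists (nrm g w) => x [kx Tx].
  have -> : dot y x = dot p x.
    by apply/eqP; rewrite -subr_eq0 -(ipBl dotP) kx.
  rewrite (ipC dotP) modulusJ -wp; apply: le_trans (cauchy_schwarz gP _ _) _.
  by have := nrm_ge0 g w; nra.
exists (`|B| + 1) => [|x]; first by rewrite ltr_wpDl.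
have [Tx0|Tx0] := eqVneq (nrm g (T x)) 0.
  exists x; first exact: nrm_eq0 Tx0.
  by rewrite subrr (nrm0 dotP) Tx0 mulr0.
have Txp : 0 < nrm g (T x) by rewrite lt_def Tx0 nrm_ge0.
have [u Tu hu] := projection dotH x subspace_kernel kernel_nclosed.
exists u => //.
pose c : R := (nrm g (T x))^-1.
have cp : 0 < c by rewrite invr_gt0.
have mc : modulus c%:C = c by rewrite modulusR gtr0_norm.
have /hB : S (c%:C *: (x - u)).
  split=> [m Tm|].
    by rewrite (ipZr dotP) (ipBr dotP) hu// subrr mulr0.
  by rewrite linZ (nrmZ gP) mc linB Tu subr0 mulVf.
rewrite (nrmZ dotP) mc mulrC ler_pdivrMr// => /le_trans; apply.
by rewrite ler_pM2r// (le_trans (ler_norm _))// lerDl.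
Qed.

End ClosedRange.

(** * The Gram operator of an indefinite form *)

Section IndefiniteGram.
Variables (R : realType) (H F : lmodType R[i]).
Variables (dot : H -> H -> R[i]) (g f : F -> F -> R[i]) (L : H -> F) (b : R).
Variables (J J' : F -> F) (c c' : R).
Hypothesis dotH : hilbert dot.
Hypothesis gH : hilbert g.
Hypothesis Llin : linear L.
Hypothesis Lb : forall x, nrm g (L x) <= b * nrm dot x.
Hypothesis fJ : forall x y, f x y = g x (J y).
Hypothesis fC : forall x y, f y x = (f x y)^*%R.
Hypothesis JB : forall x y, J (x - y) = J x - J y.
Hypothesis JJ' : forall x, J (J' x) = x.
Hypothesis Jb : forall x, nrm g (J x) <= c * nrm g x.
Hypothesis J'b : forall x y, nrm g (J' x - J' y) <= c' * nrm g (x - y).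
Let dotP : inner_product dot := proj1 dotH.
Let gP : inner_product g := proj1 gH.
Let Lsharp := adjoint dot f L.
Let M := range L.

(** The vector L# w exists by Riesz, because L# w = L* (J w). *)
Lemma adjointP w y : f (L y) w = dot y (Lsharp w).
Proof.
rewrite /Lsharp /adjoint.
case: xgetP => [h _ ->//|nex].
have [h hP] := adjoint_pair_exists dotH gH Llin Lb (J w).
by case: (nex h) => x; rewrite fJ hP.
Qed.

Lemma ip_inj h h' : (forall y, dot y h = dot y h') -> h = h'.
Proof.
move=> e; apply/eqP; rewrite -subr_eq0; apply/eqP.
have [_ _ _] := dotP; apply; by rewrite (ipBr dotP) e subrr.
Qed.

Lemma formBr x y z : f z (x - y) = f z x - f z y.
Proof. by rewrite !fJ JB (ipBr gP). Qed.

Lemma form0l z : f 0 z = 0.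
Proof. by rewrite fJ (ip0l gP). Qed.

Lemma companionP w : orthogonal_companion f M w <-> forall y, f (L y) w = 0.
Proof.
split=> [h y|h _ [y _ <-]]; first by rewrite fC h ?rmorph0//; exists y.
by rewrite fC h rmorph0.
Qed.

Lemma nullspace_gram x :
  nullspace (Lsharp \o L) x <-> orthogonal_companion f M (L x).
Proof.
rewrite companionP; split=> [Lx0 y|h].
  by rewrite adjointP [Lsharp _]Lx0 (ip0r dotP).
by apply: ip_inj => y; rewrite (ip0r dotP) -adjointP h.
Qed.

(** Since N(L#) is the companion of R(L), the isotropic part of R(L) is
    the image of N(L#L) under L. *)
Lemma range_nondegenerate :
  nondegenerate_subspace f M <-> nullspace (Lsharp \o L) = nullspace L.
Proof.
split=> [nd|e].
  apply/seteqP; split=> x.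
    move=> /nullspace_gram Lx.
    suff : (M `&` orthogonal_companion f M) (L x) by rewrite nd.
    by split=> //; exists x.
  by move=> Lx0; apply/nullspace_gram; rewrite [L x]Lx0 => m _; rewrite form0l.
apply/seteqP; split=> [_ [[x _ <-] /nullspace_gram]|_ ->]; first by rewrite e.
split; last by move=> m _; rewrite form0l.
by exists 0; rewrite // (lin0 Llin).
Qed.

Lemma adjoint_bounded w h :
  (forall y, f (L y) w = dot y h) -> nrm dot h <= `|b| * `|c| * nrm g w.
Proof.
move=> /(_ h); rewrite fJ => e.
have [h0|h0] := eqVneq (nrm dot h) 0.
  by rewrite h0 !mulr_ge0 ?nrm_ge0.
have hp : 0 < nrm dot h by rewrite lt_def h0 nrm_ge0.
rewrite -(ler_pM2l hp) -expr2.
have := cauchy_schwarz gP (L h) (J w).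
rewrite e (ip_self dotP) modulusR ger0_norm ?sqr_ge0// => /le_trans; apply.
have -> : nrm dot h * (`|b| * `|c| * nrm g w) =
  (`|b| * nrm dot h) * (`|c| * nrm g w) by ring.
apply: ler_pM; rewrite ?nrm_ge0//.
  by apply: le_trans (Lb _) _; rewrite ler_wpM2r ?nrm_ge0// ler_norm.
by apply: le_trans (Jb _) _; rewrite ler_wpM2r ?nrm_ge0// ler_norm.
Qed.

(** R(L) + N(L#) is the preimage of R(L#L) under the bounded operator
    L#. *)
Lemma sum_companion_closed : nclosed dot (range (Lsharp \o L)) ->
  nclosed g (sumset M (orthogonal_companion f M)).
Proof.
move=> clR x hx.
have [y _ /= ey] : range (Lsharp \o L) (Lsharp x).
  apply: clR => e e0.
  have k0 : 0 < `|b| * `|c| + 1 by rewrite ltr_wpDl ?mulr_ge0.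
  have [|_ [_ [y _ <-] [n /companionP hn <-]] xa] := hx (e / (`|b| * `|c| + 1)).
    by rewrite divr_gt0.
  exists (Lsharp (L y)); first by exists y.
  have := @adjoint_bounded (x - (L y + n)) (Lsharp x - Lsharp (L y)).
  have -> : x - (L y + n) = (x - L y) - n by rewrite opprD addrA.
  move=> /(_ _)/le_lt_trans; apply.
    by move=> z; rewrite !formBr hn subr0 !adjointP (ipBr dotP).
  move: xa; rewrite ltr_pdivlMr// opprD addrA.
  by have := nrm_ge0 g (x - L y - n); nra.
exists (L y); first by exists y.
exists (x - L y); last by rewrite addrC subrK.
by apply/companionP => z; rewrite formBr !adjointP ey subrr.
Qed.

(** If L#L (x n) tends to l, then the L (x n) need not converge, but they
    do modulo the companion of R(L): L#L (x n) = L* (p n), where p n is the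
    projection of J (L (x n)) on R(L), and p n converges because L* is bounded
    below on R(L). *)
Lemma range_gram_closed : nclosed g M ->
  nclosed g (sumset M (orthogonal_companion f M)) ->
  nclosed dot (range (Lsharp \o L)).
Proof.
move=> clM clS; apply: (nclosed_seq dotP) => u l Ru ul.
have /choice[x xP] n : exists x, Lsharp (L x) = u n.
  by have [x _ <-] := Ru n; exists x.
have sM : Defs.subspace M by exact: subspace_range.
have /choice[p pP] n : exists p,
    M p /\ forall m, M m -> g m (J (L (x n))) = g m p.
  by have [p Mp hp] := projection gH (J (L (x n))) sM clM; exists p.
have pu n : adjoint_pair dot g L (p n) (u n).
  by move=> y; rewrite -(pP n).2; [rewrite -fJ adjointP xP | exists y].
have [q [Mq pq ql]] :=
  adjoint_pair_lim dotH gH Llin clM (fun n => (pP n).1) pu ul.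
(* J' (p n) is in R(L) + R(L)^[_|_], because it has the same products
   with R(L) as L (x n). *)
have : sumset M (orthogonal_companion f M) (J' q).
  apply: (nclosed_lim gH (u := fun n => J' (p n)) clS).
    move=> n; exists (L (x n)); first by exists (x n).
    exists (J' (p n) - L (x n)); last by rewrite addrC subrK.
    apply/companionP => y; rewrite formBr !fJ JJ' (pP n).2 ?subrr//.
    by exists y.
  move=> e e0; have k0 : 0 < `|c'| + 1 by rewrite ltr_wpDl.
  have [|N hN] := pq (e / (`|c'| + 1)); first by rewrite divr_gt0.
  exists N => n Nn; apply: le_lt_trans (J'b _ _) _.
  have := hN n Nn; rewrite ltr_pdivlMr//.
  by have := nrm_ge0 g (p n - q); have := ler_norm c'; nra.
move=> [_ [y _ <-] [n /companionP hn e]].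
exists y => //=; apply: ip_inj => z.
have -> : L y = J' q - n by rewrite -e addrK.
by rewrite -adjointP formBr hn subr0 fJ JJ' ql.
Qed.

End IndefiniteGram.

(** * Products and the range of a pair of operators *)

Section Product.
Variables (R : realType) (K E : lmodType R[i]).
Variables (gK : K -> K -> R[i]) (gE : E -> E -> R[i]).

Definition ip_prod (p q : K * E) : R[i] := gK p.1 q.1 + gE p.2 q.2.

Hypothesis KH : hilbert gK.
Hypothesis EH : hilbert gE.
Let KP : inner_product gK := proj1 KH.
Let EP : inner_product gE := proj1 EH.

Lemma ip_prodP : inner_product ip_prod.
Proof.
split.
- by move=> a x y z; rewrite /ip_prod /= (ip_linl KP) (ip_linl EP); ring.
- by move=> x y; rewrite /ip_prod (ipC KP x.1) (ipC EP x.2) rmorphD.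
- by move=> x; rewrite addr_ge0//; [case: KP | case: EP].
move=> [x y]; rewrite /ip_prod /= (ip_self KP) (ip_self EP) -rmorphD.
move=> /complexI/eqP; rewrite paddr_eq0 ?sqr_ge0// !sqrf_eq0.
move=> /andP[/eqP x0 /eqP y0].
by rewrite (nrm_eq0 KP x0) (nrm_eq0 EP y0).
Qed.

Lemma sqr_nrm_prod p : nrm ip_prod p ^+ 2 = nrm gK p.1 ^+ 2 + nrm gE p.2 ^+ 2.
Proof. by rewrite (sqr_nrm ip_prodP) (sqr_nrm KP) (sqr_nrm EP) -complexReD. Qed.

Lemma nrm_fst p : nrm gK p.1 <= nrm ip_prod p.
Proof.
rewrite -(@ler_pXn2r _ 2) ?nnegrE ?nrm_ge0// sqr_nrm_prod.
by rewrite lerDl sqr_ge0.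
Qed.

Lemma nrm_snd p : nrm gE p.2 <= nrm ip_prod p.
Proof.
rewrite -(@ler_pXn2r _ 2) ?nnegrE ?nrm_ge0// sqr_nrm_prod.
by rewrite lerDr sqr_ge0.
Qed.

Lemma nrm_prod_le p : nrm ip_prod p <= nrm gK p.1 + nrm gE p.2.
Proof.
have p1 := nrm_ge0 gK p.1; have p2 := nrm_ge0 gE p.2.
rewrite -(@ler_pXn2r _ 2) ?nnegrE ?nrm_ge0 ?addr_ge0// sqr_nrm_prod.
by rewrite sqrrD lerD2r lerDl mulrn_wge0// mulr_ge0.
Qed.

Lemma hilbert_prod : hilbert ip_prod.
Proof.
split=> [|u uC]; first exact: ip_prodP.
have [|k hk] := KH.2 (fun n => (u n).1).
  move=> e /uC[N hN]; exists N => m n Nm Nn.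
  exact: le_lt_trans (nrm_fst (u m - u n)) (hN _ _ Nm Nn).
have [|z hz] := EH.2 (fun n => (u n).2).
  move=> e /uC[N hN]; exists N => m n Nm Nn.
  exact: le_lt_trans (nrm_snd (u m - u n)) (hN _ _ Nm Nn).
exists (k, z) => e e0; have e2 : 0 < e / 2 by rewrite divr_gt0.
have [N1 h1] := hk _ e2; have [N2 h2] := hz _ e2.
exists (maxn N1 N2) => n; rewrite geq_max => /andP[/h1 a1 /h2 a2].
by apply: le_lt_trans (nrm_prod_le _) _; rewrite /=; lra.
Qed.

End Product.

Section PairRange.
Variables (R : realType) (H K E : lmodType R[i]).
Variables (dot : H -> H -> R[i]) (gK : K -> K -> R[i]) (gE : E -> E -> R[i]).
Variables (T : H -> K) (V : H -> E) (bT bV : R).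
Hypothesis dotH : hilbert dot.
Hypothesis KH : hilbert gK.
Hypothesis EH : hilbert gE.
Hypothesis Tlin : linear T.
Hypothesis Vlin : linear V.
Hypothesis Tb : forall x, nrm gK (T x) <= bT * nrm dot x.
Hypothesis Vb : forall x, nrm gE (V x) <= bV * nrm dot x.
Hypothesis clT : nclosed gK (range T).
Hypothesis clV : nclosed gE (range V).
Let dotP : inner_product dot := proj1 dotH.
Let KP : inner_product gK := proj1 KH.
Let EP : inner_product gE := proj1 EH.
Let L x := (T x, V x).

Lemma pair_bounded x : nrm (ip_prod gK gE) (L x) <= (bT + bV) * nrm dot x.
Proof.
apply: le_trans (nrm_prod_le KH EH _) _; rewrite mulrDl.
exact: lerD (Tb x) (Vb x).
Qed.

(** If (y, z) is in the closure of R(L), then y = T a and z = V b because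
    both ranges are closed, and any x with L x close to (y, z) is close to a
    modulo N(T) and to b modulo N(V).  Thus a - b is close to N(T) + N(V). *)
Lemma range_pair_closed : nclosed (ip_prod gK gE) (range L) <->
  nclosed dot (sumset (nullspace T) (nullspace V)).
Proof.
split=> [clL w hw|clN [y z] hyz].
  have [x _ [Tx Vx]] : range L (0, V w).
    apply: clL => e e0; have k0 : 0 < `|bV| + 1 by rewrite ltr_wpDl.
    have [|_ [u Tu [v Vv <-]] wuv] := hw (e / (`|bV| + 1)).
      by rewrite divr_gt0.
    exists (L u); first by exists u.
    apply: le_lt_trans (nrm_prod_le KH EH _) _ => /=.
    rewrite [T u]Tu subrr (nrm0 KP) add0r.
    have -> : V w - V u = V (w - (u + v)).
      by rewrite (linB Vlin) (linD Vlin) [V v]Vv addr0.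
    apply: le_lt_trans (Vb _) _; move: wuv; rewrite ltr_pdivlMr//.
    by have := nrm_ge0 dot (w - (u + v)); have := ler_norm bV; nra.
  exists x; first exact: Tx.
  exists (w - x); last by rewrite addrC subrK.
  by rewrite /nullspace /= (linB Vlin) Vx subrr.
have [a _ ay] : range T y.
  apply: clT => e /hyz[_ [x _ <-] h]; exists (T x); first by exists x.
  exact: le_lt_trans (nrm_fst KH EH _) h.
have [b _ bz] : range V z.
  apply: clV => e /hyz[_ [x _ <-] h]; exists (V x); first by exists x.
  exact: le_lt_trans (nrm_snd KH EH _) h.
have [C1 C10 h1] := bounded_inverse dotH KH Tlin Tb clT.
have [C2 C20 h2] := bounded_inverse dotH EH Vlin Vb clV.
have [u Tu [v Vv uv]] : sumset (nullspace T) (nullspace V) (a - b).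
  apply: clN => e e0; have C0 : 0 < C1 + C2 by rewrite addr_gt0.
  have [|_ [x _ <-] h] := hyz (e / (C1 + C2)); first by rewrite divr_gt0.
  have [u Tu hu] := h1 (a - x); have [v Vv hv] := h2 (b - x).
  exists (u - v).
    exists u => //; exists (- v) => //.
    by rewrite /nullspace /= -sub0r (linB Vlin) (lin0 Vlin) Vv subrr.
  have -> : a - b - (u - v) = (a - x - u) - (b - x - v).
    rewrite [in RHS](addrAC a) [in RHS](addrAC b) [- (_ - x)]opprB subrKA.
    rewrite !opprB !addrA.
    by rewrite addrAC (addrAC a) addrAC.
  apply: le_lt_trans (nrmD dotP _ _) _; rewrite (nrmN dotP).
  move: hu hv h; rewrite (linB Tlin) (linB Vlin) ay bz ltr_pdivlMr//.
  have := nrm_fst KH EH ((y, z) - L x); have := nrm_snd KH EH ((y, z) - L x).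
  by rewrite /=; move: (nrm _ (_ - T x)) (nrm _ (_ - V x)) => s t; nra.
exists (a - u) => //; rewrite /L (linB Tlin) [T u]Tu subr0 ay.
have -> : a - u = b + v.
  have -> : a = u + (v + b) by rewrite addrA uv subrK.
  by rewrite addrC addKr addrC.
by rewrite (linD Vlin) [V v]Vv addr0 bz.
Qed.

End PairRange.

(** * Equivalent norms and the topology *)

Section NormBridge.
Variables (R : realType) (W : normedModType R[i]).
Implicit Types (x y : W) (A : set W) (g : W -> W -> R[i]).

Definition rnorm x : R := complex.Re `|x|.

Lemma rnormE x : `|x| = (rnorm x)%:C.
Proof. by rewrite RRe_real// ger0_real. Qed.

Lemma rnorm_ge0 x : 0 <= rnorm x.
Proof. by rewrite -ler0c -rnormE. Qed.

Definition norm_equiv g := exists a b : R, [/\ 0 < a, 0 < b &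
  forall x, rnorm x <= a * nrm g x /\ nrm g x <= b * rnorm x].

Lemma complex_posE (e : R[i]) :
  0 < e -> e = (complex.Re e)%:C /\ 0 < complex.Re e.
Proof.
move=> e0; have eE : e = (complex.Re e)%:C by rewrite RRe_real// gtr0_real.
by split=> //; rewrite -ltcR -eE.
Qed.

Lemma closed_rnorm A : closed A <->
  forall x, (forall e : R, 0 < e -> exists2 a, A a & rnorm (x - a) < e) -> A x.
Proof.
split=> [clA x xA|h x xA].
  apply: clA => B /nbhs_ballP[e /= /complex_posE[-> e0]] eB.
  have [a Aa xa] := xA _ e0; exists a; split=> //; apply: eB.
  by rewrite -ball_normE /= rnormE ltcR.
apply: h => e e0; have [|a [Aa]] := xA (ball x e%:C).
  by apply: nbhsx_ballx; rewrite ltcR.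
by rewrite -ball_normE /= rnormE ltcR => xa; exists a.
Qed.

Lemma closed_nclosed A g : norm_equiv g -> closed A <-> nclosed g A.
Proof.
move=> [a [b [a0 b0 ab]]]; rewrite closed_rnorm.
split=> h x hx; apply: h => e e0.
  have [|y Ay xy] := hx (e / a); first by rewrite divr_gt0.
  exists y => //; apply: le_lt_trans (ab _).1 _.
  by rewrite mulrC -ltr_pdivlMr.
have [|y Ay xy] := hx (e / b); first by rewrite divr_gt0.
exists y => //; apply: le_lt_trans (ab _).2 _.
by rewrite mulrC -ltr_pdivlMr.
Qed.

End NormBridge.

Lemma complete_hilbert (R : realType) (W : completeNormedModType R[i])
  (g : W -> W -> R[i]) : inner_product g -> norm_equiv g -> hilbert g.
Proof.
move=> gP [a [b [a0 b0 ab]]]; split=> // u uC.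
have : cauchy (u @ \oo).
  apply/cauchy_ballP => e /complex_posE[-> e0].
  have [|N hN] := uC (complex.Re e / a); first by rewrite divr_gt0.
  exists (u @` [set n | (N <= n)%N], u @` [set n | (N <= n)%N]).
    by split; exists N => // n Nn; exists n.
  move=> [_ _] [/= [m Nm <-] [n Nn <-]].
  rewrite -ball_normE /= rnormE ltcR; apply: le_lt_trans (ab _).1 _.
  by rewrite mulrC -ltr_pdivlMr// hN.
move=> /cauchy_cvg/cvg_ex[l ul]; exists l => e e0.
have /cvgrPdist_lt/(_ (e / b)%:C) := ul.
rewrite ltcR divr_gt0// => /(_ isT)[N _ hN]; exists N => n Nn.
apply: le_lt_trans (ab _).2 _; rewrite mulrC -ltr_pdivlMr//.
by rewrite -ltcR -rnormE distrC; exact: hN.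
Qed.

Lemma continuous_rnorm_bounded (R : realType) (U W : normedModType R[i])
  (T : {linear U -> W}) : continuous T ->
  exists b : R, forall x, rnorm (T x) <= b * rnorm x.
Proof.
move=> Tc; have /linear_boundedP := continuous_linear_bounded 0 (Tc 0).
move=> [M [Mr hM]].
have [m Mm] : exists m, M = m%:C by exists (complex.Re M); rewrite RRe_real.
exists (m + 1) => x; rewrite -lecR rmorphM /= -!rnormE; apply: hM.
by rewrite Mm ltcR ltrDl.
Qed.

Lemma bounded_equiv (R : realType) (U W : normedModType R[i])
  (T : {linear U -> W}) gU gW :
  continuous T -> norm_equiv gU -> norm_equiv gW ->
  exists b : R, forall x, nrm gW (T x) <= b * nrm gU x.
Proof.
move=> /continuous_rnorm_bounded[t hT] [a [a' [_ _ ab]]] [b' [b [_ b_gt0 cd]]].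
exists (b * (`|t| * a)) => x; apply: le_trans (cd _).2 _.
rewrite -!mulrA ler_pM2l//; apply: le_trans (hT _) _.
apply: (@le_trans _ _ (`|t| * rnorm x)).
  by rewrite ler_wpM2r ?rnorm_ge0// ler_norm.
by rewrite ler_wpM2l// (ab _).1.
Qed.

Lemma hilbert_norm_equiv (R : realType) (H : normedModType R[i])
  (dot : {dot H for Num.conj}) : hilbert_norm dot ->
  inner_product dot /\ norm_equiv dot.
Proof.
move=> dotH; have P : inner_product dot.
  split.
  - by move=> a x y z; rewrite linearPl.
  - by move=> x y; rewrite hermC /= expr0 mul1r.
  - by move=> x; rewrite -dotH exprn_ge0.
  - by move=> x /eqP; rewrite -dotH expf_eq0 /= normr_eq0 => /eqP.
split=> //; exists 1, 1; split=> // x; rewrite !mul1r.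
suff -> : rnorm x = nrm dot x by [].
by rewrite /nrm -dotH rnormE -rmorphXn /= sqrtr_sqr ger0_norm ?rnorm_ge0.
Qed.

Lemma prod_norm_equiv (R : realType) (K E : normedModType R[i])
  (gK : K -> K -> R[i]) (gE : E -> E -> R[i]) :
  hilbert gK -> hilbert gE -> norm_equiv gK -> norm_equiv gE ->
  norm_equiv (ip_prod gK gE : (K * E)%type -> (K * E)%type -> R[i]).
Proof.
move=> KH EH [a [b [a0 b0 ab]]] [c [d [c0 d0 cd]]].
have nE (p : K * E) : rnorm p = Num.max (rnorm p.1) (rnorm p.2).
  apply: complexI; rewrite -rnormE prod_normE !rnormE.
  by rewrite /Order.max ltcR; case: ifP.
exists (a + c), (b + d); split; rewrite ?addr_gt0// => p; split.
  rewrite nE ge_max mulrDl; apply/andP; split.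
    rewrite (le_trans (ab _).1)//.
    rewrite ler_wpDr ?mulr_ge0 ?nrm_ge0 ?(ltW a0) ?(ltW c0)//.
    by rewrite ler_pM2l// (nrm_fst KH EH).
  rewrite (le_trans (cd _).1)//.
  rewrite ler_wpDl ?mulr_ge0 ?nrm_ge0 ?(ltW a0) ?(ltW c0)//.
  by rewrite ler_pM2l// (nrm_snd KH EH).
apply: le_trans (nrm_prod_le KH EH _) _; rewrite mulrDl lerD//.
  by rewrite (le_trans (ab _).2)// ler_pM2l// nE le_max lexx.
by rewrite (le_trans (cd _).2)// ler_pM2l// nE le_max lexx orbT.
Qed.

(** * Krein spaces *)

(** P and Q = id - P are the projections given by a fundamental
    decomposition, and J = P - Q is its fundamental symmetry.  The two parts
    are orthogonal, so [x, J y] = [P x, P y] - [Q x, Q y], which is positive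
    definite. *)
Lemma krein_inner_product (R : realType) (K : normedModType R[i])
  (f : {hermitian K for false & Num.conj}) : krein_space f ->
  exists (g : K -> K -> R[i]) (J : K -> K), [/\ inner_product g, norm_equiv g,
    forall x y, f x y = g x (J y),
    (forall x y, J (x - y) = J x - J y) /\ (forall x, J (J x) = x) &
    forall x, nrm g (J x) = nrm g x].
Proof.
move=> [Kp [Km [dec [a [b [a0 b0 ab]]]]]].
have [[[Kp0 KpL] pos _] [[Km0 KmL] neg _] orth sum] := dec.
have KpB x y : Kp x -> Kp y -> Kp (x - y).
  by move=> Kx Ky; rewrite addrC -scaleN1r; apply: KpL.
have KmB x y : Km x -> Km y -> Km (x - y).
  by move=> Kx Ky; rewrite addrC -scaleN1r; apply: KmL.
have fC x y : f y x = (f x y)^*%R by rewrite hermC /= expr0 mul1r.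
have /choice[P PP] x : exists p, Kp p /\ Km (x - p).
  have : sumset Kp Km x by rewrite sum.
  by move=> [p Kpp [q Kmq <-]]; exists p; rewrite [p + q]addrC addrK.
(* The sum of the two parts is direct, since the form cannot be both
   positive and negative at a nonzero vector. *)
have uniqP x p : Kp p -> Km (x - p) -> P x = p.
  move=> Kpp Kmp; have [KP KQ] := PP x; apply/eqP; rewrite -subr_eq0.
  apply/negPn/negP => n0.
  have h1 := pos _ (KpB _ _ KP Kpp) n0.
  have KmPp : Km (P x - p).
    have -> : P x - p = (x - p) - (x - P x) by rewrite opprB [RHS]addrC subrKA.
    exact: KmB.
  have := neg _ KmPp n0; rewrite oppr_gt0 => h2.
  by have := lt_trans h1 h2; rewrite ltxx.
pose Q x := x - P x; pose J x := P x - Q x; pose g x y := f x (J y).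
have subACA (x y z t : K) : x - y - (z - t) = (x - z) - (y - t).
  by rewrite opprD addrACA -opprD.
have PB x y : P (x - y) = P x - P y.
  apply: uniqP; first by apply: KpB; case: (PP x); case: (PP y).
  by rewrite subACA; apply: KmB; [case: (PP x) | case: (PP y)].
have JB x y : J (x - y) = J x - J y.
  by rewrite /J /Q PB [x - y - _]subACA [LHS]subACA.
have fPQ x y : f (P x) (Q y) = 0.
  by apply: orth; [case: (PP x) | case: (PP y)].
have fQP x y : f (Q x) (P y) = 0 by rewrite fC fPQ rmorph0.
have gE x y : g x y = f (P x) (P y) - f (Q x) (Q y).
  have fBr z : f z (P y - Q y) = f z (P y) - f z (Q y) by rewrite linearBr.
  have -> : g x y = f (Q x) (P y - Q y) + f (P x) (P y - Q y).
    by rewrite -linearDl subrK.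
  by rewrite !fBr fPQ fQP sub0r subr0 addrC.
have PJ x : P (J x) = P x.
  apply: uniqP; first by case: (PP x).
  rewrite /J addrC addrA addNr add0r -sub0r.
  by apply: KmB => //; case: (PP x).
have JJ x : J (J x) = x.
  rewrite {1}/J /Q PJ /J [P x - _ - _]addrAC subrr sub0r opprK.
  by rewrite /Q addrC subrK.
have fp x : 0 <= f (P x) (P x) ?= iff (P x == 0).
  split; last first.
    have [->|/pos] := eqVneq (P x) 0; first by rewrite linear0l eqxx.
    by case: (PP x) => KP _ /(_ KP) h; rewrite lt_eqF.
  have [->|/pos] := eqVneq (P x) 0; first by rewrite linear0l.
  by case: (PP x) => KP _ /(_ KP)/ltW.
have fq x : 0 <= - f (Q x) (Q x) ?= iff (Q x == 0).
  split; last first.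
    have [->|/neg] := eqVneq (Q x) 0; first by rewrite linear0l oppr0 eqxx.
    by case: (PP x) => _ KQ /(_ KQ) h; rewrite lt_eqF.
  have [->|/neg] := eqVneq (Q x) 0; first by rewrite linear0l oppr0.
  by case: (PP x) => _ KQ /(_ KQ)/ltW.
have gP : inner_product g.
  split.
  - by move=> c x y z; rewrite /g linearPl.
  - by move=> x y; rewrite !gE rmorphB /= -!fC.
  - by move=> x; rewrite gE addr_ge0 ?fp ?fq.
  move=> x /eqP; rewrite gE paddr_eq0 ?fp ?fq//.
  rewrite [f _ _ == 0]eq_sym fp [- f _ _ == 0]eq_sym fq.
  move=> /andP[/eqP Px /eqP Qx].
  by rewrite -[x](subrK (P x)) -/(Q x) Px Qx addr0.
exists g, J; split=> //.
- have [aE ap] := complex_posE a0; have [bE bp] := complex_posE b0.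
  move: aE bE ap bp.
  set a1 := complex.Re a; set b1 := complex.Re b => aE bE ap bp.
  have bd x : a1 * rnorm x ^+ 2 <= nrm g x ^+ 2 <= b1 * rnorm x ^+ 2.
    have [KP KQ] := PP x; have := ab _ _ KP KQ.
    by rewrite -/(Q x) -gE [P x + _]addrC subrK (ip_self gP) rnormE aE bE
      -rmorphXn -!rmorphM /= !lecR.
  exists (Num.sqrt a1)^-1, (Num.sqrt b1).
  split; rewrite ?invr_gt0 ?sqrtr_gt0// => x.
  have /andP[h1 h2] := bd x; split.
    rewrite mulrC ler_pdivlMr ?sqrtr_gt0//.
    rewrite -(@ler_pXn2r _ 2) ?nnegrE;
      rewrite ?mulr_ge0 ?rnorm_ge0 ?nrm_ge0 ?sqrtr_ge0//.
    by rewrite exprMn sqr_sqrtr ?(ltW ap)// mulrC.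
  rewrite -(@ler_pXn2r _ 2) ?nnegrE ?mulr_ge0 ?rnorm_ge0 ?nrm_ge0 ?sqrtr_ge0//.
  by rewrite exprMn [Num.sqrt b1 ^+ 2]sqr_sqrtr ?(ltW bp).
- by move=> x y; rewrite /g JJ.
move=> x; rewrite /nrm /g JJ [f (J x) x]fC.
by congr Num.sqrt; apply: complexReJ.
Qed.

(** * The range of L *)

Theorem proposition4p3 (R : realType)
  (H K E : completeNormedModType R[i])
  (dot : {dot H for Num.conj})
  (fK : {hermitian K for false & Num.conj})
  (fE : {hermitian E for false & Num.conj})
  (dotH : hilbert_norm dot) (sepH : separable H)
  (kreinK : krein_space fK) (kreinE : krein_space fE)
  (T : {linear H -> K}) (V : {linear H -> E})
  (T_cont : continuous T) (V_cont : continuous V)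
  (T_closed : closed (range T)) (V_closed : closed (range V))
  (rho : R) (rho_neq0 : rho != 0) :
  let L := fun x : H => (T x, V x) in
  let f := prod_form fK fE rho in
  let Lsharp := adjoint dot f L in
  [/\ closed (range L) <-> closed (sumset (nullspace T) (nullspace V)),
      nondegenerate_subspace f (range L) <->
        nullspace (Lsharp \o L) = nullspace T `&` nullspace V &
      pseudo_regular f (range L) <->
        closed (sumset (nullspace T) (nullspace V)) /\
        closed (range (Lsharp \o L))].
Proof.
have [dotP dotN] := hilbert_norm_equiv dotH.
have HH := complete_hilbert dotP dotN.
have [gK [JK [KP KN fKE [JKB JKK] JKn]]] := krein_inner_product kreinK.
have [gE [JE [EP EN fEE [JEB JEE] JEn]]] := krein_inner_product kreinE.
have KH := complete_hilbert KP KN.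
have EH := complete_hilbert EP EN.
have FH := hilbert_prod KH EH.
have FN := prod_norm_equiv KH EH KN EN.
have [bT Tb] := bounded_equiv T_cont dotN KN.
have [bV Vb] := bounded_equiv V_cont dotN EN.
have Tlin : linear T := @linearP _ _ _ _ T.
have Vlin : linear V := @linearP _ _ _ _ V.
move=> L f Lsharp.
have Llin : linear L by move=> a x y; rewrite /L Tlin Vlin.
have Lb x : nrm (ip_prod gK gE) (L x) <= (bT + bV) * nrm dot x.
  exact: pair_bounded KH EH Tb Vb x.
pose r : R[i] := rho%:C.
have r0 : r != 0 by rewrite fmorph_eq0.
(* J is the Gram operator of the form with respect to the product inner
   product, and J' is its inverse. *)
pose J (q : K * E) : K * E := (JK q.1, r *: JE q.2).
pose J' (q : K * E) : K * E := (JK q.1, JE (r^-1 *: q.2)).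
have fJ p q : f p q = ip_prod gK gE p (J q).
  rewrite /f /prod_form /ip_prod fKE fEE /= (ipZr EP).
  by rewrite conjC_conjc conjc_real.
have fC p q : f q p = (f p q)^*%R.
  rewrite /f /prod_form rmorphD rmorphM /= -/r.
  rewrite (_ : r^*%R = r); last by rewrite conjC_conjc conjc_real.
  by rewrite [fK q.1 p.1]hermC [fE q.2 p.2]hermC /= !expr0 !mul1r.
have JB p q : J (p - q) = J p - J q by rewrite /J /= JKB JEB scalerBr.
have JJ' p : J (J' p) = p.
  by case: p => y z; rewrite /J /J' /= JKK JEE scalerA divff// scale1r.
have Jb p :
    nrm (ip_prod gK gE) (J p) <= (1 + modulus r) * nrm (ip_prod gK gE) p.
  apply: le_trans (nrm_prod_le KH EH _) _.
  rewrite /= JKn (nrmZ EP) JEn mulrDl mul1r.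
  by rewrite lerD ?(nrm_fst KH EH)// ler_wpM2l ?modulus_ge0 ?(nrm_snd KH EH).
have J'b p q : nrm (ip_prod gK gE) (J' p - J' q) <=
    (1 + modulus r^-1) * nrm (ip_prod gK gE) (p - q).
  apply: le_trans (nrm_prod_le KH EH _) _.
  rewrite /= -JKB -JEB JKn JEn -scalerBr (nrmZ EP) mulrDl mul1r.
  rewrite lerD ?(nrm_fst KH EH (p - q))//.
  by rewrite ler_wpM2l ?modulus_ge0 ?(nrm_snd KH EH (p - q)).
have clT : nclosed gK (range T) by apply/(closed_nclosed _ KN).
have clV : nclosed gE (range V) by apply/(closed_nclosed _ EN).
have i_ : closed (range L) <-> closed (sumset (nullspace T) (nullspace V)).
  rewrite (closed_nclosed _ FN) (closed_nclosed _ dotN).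
  exact: range_pair_closed HH KH EH Tlin Vlin Tb Vb clT clV.
have nullL : nullspace L = nullspace T `&` nullspace V.
  apply/seteqP; split=> [x []//|x [Tx Vx]].
  by rewrite /nullspace /= /L Tx Vx.
split=> //.
  rewrite -nullL.
  exact: range_nondegenerate HH FH Llin Lb fJ fC.
rewrite /pseudo_regular i_; split=> -[clN clR]; split=> //.
  apply/(closed_nclosed _ dotN).
  apply: (range_gram_closed HH FH Llin Lb fJ fC JB JJ' J'b).
    by apply/(closed_nclosed _ FN)/i_.
  by apply/(closed_nclosed _ FN).
apply/(closed_nclosed _ FN).
apply: (sum_companion_closed HH FH Llin Lb fJ fC JB Jb).
by apply/(closed_nclosed _ dotN).
Qed.
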